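(* Let $q\ge 1$ and let $R=\mathbf{Z}[B_{i,j} : 1\le i,j\le q]$ be the commutative polynomial ring over $\mathbf{Z}$ in the $q^2$ independent indeterminates $B_{i,j}$. For $1\le n\le q$ let $C_{n,n}\in R$ be the polynomial $$C_{n,n}=\sum_{(i_1,\ldots,i_c)\in D_n} B_{n,i_1}B_{i_1,i_2}B_{i_2,i_3}\cdots B_{i_{c-1},i_c}B_{i_c,n},$$ where $D_n$ is the set of admissible sequences with entries in $\{1,\ldots,n-1\}$. Then the ideal $I'$ of $R$ generated by the polynomials $$1+C_{1,1},\quad 1+C_{2,2},\quad \ldots,\quad 1+C_{q,q}$$ is equal to the ideal $I$ of $R$ generated by the polynomials $$L_n=\det\left(B_{i,j}\right)_{1\le i,j\le n}-(-1)^n,\qquad n=1,\ldots,q$$ (so $L_1=B_{1,1}+1$, $L_2=B_{1,1}B_{2,2}-B_{1,2}B_{2,1}-1$, and so on).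
   Context: A finite sequence of positive integers is called admissible if for all $s\ge 1$, between any two appearances of $s$ in the sequence there is a number greater than $s$ which appears between them. For $n\ge 1$, $D_n$ denotes the set of all admissible sequences composed of the numbers $1,2,\ldots,n-1$ (including the empty sequence; $D_1=\{\varnothing\}$). The empty sequence contributes the term $B_{n,n}$ to $C_{n,n}$; for instance $C_{1,1}=B_{1,1}$ and $C_{2,2}=B_{2,2}+B_{2,1}B_{1,2}$. *)

(* Defs.v *)
From HB Require Import structures.
From mathcomp Require Import all_boot all_order all_algebra finmap.
From mathcomp Require Import mpoly zify.

Set Implicit Arguments.
Unset Strict Implicit.
Unset Printing Implicit Defensive.

Import GRing.Theory.
Local Open Scope ring_scope.

(* Indices are 0-based: the ordinal [k : 'I_q] stands for the number k + 1 of  *)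
(* {1, ..., q}, so that [i < n] in 'I_q encodes "i is in {1, ..., n - 1}".     *)
(* Admissibility only depends on the relative order of the entries, hence is   *)
(* insensitive to this shift.                                                  *)
Definition admissible (s : seq nat) : bool :=
  [forall i : 'I_(size s), forall j : 'I_(size s),
     (i < j)%N && (nth 0%N s i == nth 0%N s j) ==>
     [exists k : 'I_(size s), (i < k < j)%N && (nth 0%N s i < nth 0%N s k)%N]].

Definition admissible_below (q : nat) (n : 'I_q) (s : seq 'I_q) : bool :=
  admissible [seq val i | i <- s] && all (fun i : 'I_q => (i < n)%N) s.

Definition seqs_shorter (q m : nat) : seq (seq 'I_q) :=
  flatten [seq [seq tval t | t : c.-tuple 'I_q] | c <- iota 0 m].

(* The length bound 2 ^ n is only there to make the set finite by              *)
(* construction; it excludes no admissible sequence, see [in_D] below.         *)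
Definition D (q : nat) (n : 'I_q) : {fset seq 'I_q} :=
  [fset s in seqs_shorter q (2 ^ n) | admissible_below n s]%fset.

Lemma admissibleP (s : seq nat) :
  reflect (forall i j, (i < j < size s)%N -> nth 0%N s i = nth 0%N s j ->
             exists2 k, (i < k < j)%N & (nth 0%N s i < nth 0%N s k)%N)
          (admissible s).
Proof.
apply: (iffP idP) => [adm i j /andP[ij js] eq_ij | adm].
  have is_ : (i < size s)%N := ltn_trans ij js.
  move: adm => /forallP/(_ (Ordinal is_))/forallP/(_ (Ordinal js)).
  rewrite /= ij eq_ij eqxx /= => /existsP[k /andP[]].
  by exists k.
apply/forallP => i; apply/forallP => j; apply/implyP => /andP[ij /eqP eq_ij].
have [|k /andP[ik kj] lt_ik] := adm i j _ eq_ij; first by rewrite ij /=.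
by apply/existsP; exists (Ordinal (ltn_trans kj (ltn_ord j))); rewrite /= ik kj.
Qed.

Lemma admissible_size n (s : seq nat) :
  admissible s -> all (fun i => (i < n)%N) s -> (size s < 2 ^ n)%N.
Proof.
move=> /admissibleP adm /(all_nthP 0%N) lt_n.
suff range m a b : (b <= size s)%N ->
    (forall i, (a <= i < b)%N -> (nth 0 s i < m)%N) -> (b - a < 2 ^ m)%N.
  by rewrite -(subn0 (size s)); apply: range => // i /andP[_]; apply: lt_n.
elim: m a b => [|m IH] a b bs lt_m.
  have [ba | ab] := leqP b a; first by lia.
  by have := lt_m a; rewrite leqnn ab => /(_ isT).
have [/hasP[k] | /hasPn no_m] := boolP (has (fun i => nth 0%N s i == m) (index_iota a b)).
  rewrite mem_index_iota => /andP[ak kb] /eqP sk.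
  have {}lt_m i : (a <= i < b)%N -> i != k -> (nth 0 s i < m)%N.
    move=> /[dup] iab /lt_m; rewrite ltnS leq_eqVlt => /orP[/eqP si ne|//].
    have [ik|ki|e] := ltngtP i k; last by rewrite e eqxx in ne.
    - have [||l lr] := adm i k; [lia | by rewrite si sk | rewrite si].
      by have := lt_m l; lia.
    - have [||l lr] := adm k i; [lia | by rewrite si sk | rewrite sk].
      by have := lt_m l; lia.
  have h1 : (k - a < 2 ^ m)%N.
    by apply: IH => [|i ir]; [lia | apply: lt_m; lia].
  have h2 : (b - k.+1 < 2 ^ m)%N.
    by apply: IH => [|i ir]; [lia | apply: lt_m; lia].
  by rewrite expnS; lia.
have h : (b - a < 2 ^ m)%N.
  apply: IH => // i ir; have := lt_m i ir; have := no_m i.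
  by rewrite mem_index_iota ir => /(_ isT); lia.
by rewrite expnS; lia.
Qed.

Lemma in_D q (n : 'I_q) (s : seq 'I_q) : (s \in D n) = admissible_below n s.
Proof.
rewrite !inE /=; apply: andb_idl => /andP[adm s_n].
apply/flatten_mapP; exists (size s); last first.
  by apply/imageP; exists (in_tuple s).
rewrite mem_iota /= add0n -(size_map val s).
by apply: admissible_size adm _; rewrite all_map.
Qed.

Definition B (q : nat) (i j : 'I_q) : {mpoly int[q * q]} := 'X_(mxvec_index i j).

(* [walk i [:: i_1; ...; i_c] j] is B_{i,i_1} B_{i_1,i_2} ... B_{i_c,j}, and    *)
(* B_{i,j} when the sequence is empty.                                         *)
Fixpoint walk (q : nat) (i : 'I_q) (s : seq 'I_q) (j : 'I_q) :
    {mpoly int[q * q]} :=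
  if s is k :: s' then B i k * walk k s' j else B i j.

Definition C (q : nat) (n : 'I_q) : {mpoly int[q * q]} :=
  \sum_(s <- D n) walk n s n.

(* As n is 0-based, the leading principal minor has size n + 1.                *)
Definition L (q : nat) (n : 'I_q) : {mpoly int[q * q]} :=
  \det (\matrix_(i < n.+1, j < n.+1)
          B (widen_ord (ltn_ord n) i) (widen_ord (ltn_ord n) j))
  - (-1) ^+ n.+1.

Definition ideal_gen (R : comNzRingType) (I : finType) (g : I -> R) (p : R) :
    Prop :=
  exists a : I -> R, p = \sum_(i : I) a i * g i.

(* Main.v *)
(** The sums over admissible sequences with entries below [k] are computed by
    Gaussian elimination.  The largest letter [k] occurs at most once in an
    admissible word with entries at most [k], so the sum [C^(k)_{i,j}] of the
    weights of the walks from [i] to [j] through such words satisfies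
    [C^(k+1)_{i,j} = C^(k)_{i,j} + C^(k)_{i,k} C^(k)_{k,j}].  Modulo
    [1 + C^(k)_{k,k}] the pivot [C^(k)_{k,k}] is [-1] and this is the Schur
    complement step, whence [L_n = (-1)^n (1 + C_n)] (0-based) modulo the
    [1 + C_k] with [k < n].  So the two families of generators differ by a
    triangular change with diagonal entries [1] and [-1]. *)

Require Import Defs.
From mathcomp Require Import all_boot all_order all_algebra finmap.
From mathcomp Require Import mpoly zify ring.

Set Implicit Arguments.
Unset Strict Implicit.
Unset Printing Implicit Defensive.

Import GRing.Theory.
Local Open Scope ring_scope.

(** * Recursive enumeration of the admissible words *)

(** Two equal letters on either side of [k] are separated by [k] itself, two in the same factor have
    only letters of that factor between them, and [k] has no second occurrence. *)
Lemma admissible_cat_max (k : nat) (s t : seq nat) :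
  all (fun i => (i < k)%N) s -> all (fun i => (i < k)%N) t ->
  admissible (s ++ k :: t) = admissible s && admissible t.
Proof.
move=> /(all_nthP 0%N) sk /(all_nthP 0%N) tk.
have nthl i : (i < size s)%N -> nth 0%N (s ++ k :: t) i = nth 0%N s i.
  by move=> h; rewrite nth_cat h.
have nthm : nth 0%N (s ++ k :: t) (size s) = k by rewrite nth_cat ltnn subnn.
have nthr i : nth 0%N (s ++ k :: t) ((size s).+1 + i)%N = nth 0%N t i.
  rewrite nth_cat ifN; last by lia.
  by rewrite (_ : ((size s).+1 + i - size s)%N = i.+1) //; lia.
have sz : size (s ++ k :: t) = ((size s).+1 + size t)%N.
  by rewrite size_cat /= addnS.
apply/admissibleP/andP => [adm | [/admissibleP ads /admissibleP adt] i j].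
  split; apply/admissibleP => i j ij e.
    have [||l lr lt] := adm i j; first by lia.
      by rewrite !nthl //; lia.
    by exists l => //; move: lt; rewrite !nthl //; lia.
  have [||l lr lt] := adm ((size s).+1 + i)%N ((size s).+1 + j)%N.
  - by lia.
  - by rewrite !nthr.
  have lE : l = ((size s).+1 + (l - (size s).+1))%N by lia.
  exists (l - (size s).+1)%N; first by lia.
  by move: lt; rewrite lE !nthr addKn.
rewrite sz => ij.
have [js | sj | jE] := ltngtP j (size s).
- rewrite !nthl; [|lia|lia] => e.
  have [||l lr lt] := ads i j; [by lia | by [] |].
  by exists l => //; rewrite !nthl //; lia.
- have [is_ | si | ->] := ltngtP i (size s).
  + by move=> _; exists (size s); [lia | rewrite nthm nthl // sk].
  + rewrite -(subnKC si) -(subnKC sj) !nthr => e.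
    have [||l lr lt] := adt (i - (size s).+1)%N (j - (size s).+1)%N.
    * by lia.
    * by [].
    by exists ((size s).+1 + l)%N; [lia | rewrite !nthr].
  + rewrite nthm -(subnKC sj) nthr => e.
    by have := tk (j - (size s).+1)%N; rewrite -e; lia.
- have is_ : (i < size s)%N by lia.
  by rewrite jE nthm nthl // => e; have := sk i is_; rewrite e ltnn.
Qed.

Fixpoint admissible_words (k : nat) : seq (seq nat) :=
  if k is k'.+1 then
    admissible_words k' ++
    [seq s ++ k' :: t | s <- admissible_words k', t <- admissible_words k']
  else [:: [::]].

Lemma mem_admissible_words k s :
  (s \in admissible_words k) = admissible s && all (fun i => (i < k)%N) s.
Proof.
elim: k s => [|k IH] s /=.
  rewrite inE; case: s => [|x s]; last by rewrite andbF.
  by rewrite eqxx andbT; apply/esym/admissibleP => i j; rewrite ltn0 andbF.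
have ltW (r : seq nat) :
    all (fun i => (i < k)%N) r -> all (fun i => (i < k.+1)%N) r.
  by apply: sub_all => i; lia.
rewrite mem_cat IH; apply/orP/andP => [[/andP[-> /ltW ->] //|]|[adm sk]].
  case/allpairsP => -[u v] /= [].
  rewrite !IH => /andP[au uk] /andP[av vk] ->.
  by rewrite admissible_cat_max // au av all_cat /= ltnS leqnn !ltW.
have [ks | kNs] := boolP (k \in s); last first.
  left; rewrite adm; apply/allP => i si; have := allP sk i si.
  by rewrite ltnS leq_eqVlt => /orP[/eqP ei|//]; rewrite -ei si in kNs.
right; move: adm sk; case/splitPr: ks => u v adm uvk.
(* Two occurrences of the largest letter would need a larger one in between. *)
have once i j : (i < j < size (u ++ k :: v))%N ->
    nth 0%N (u ++ k :: v) i = k -> nth 0%N (u ++ k :: v) j = k -> False.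
  move=> ij ei ej; have [|l lr] := admissibleP _ adm i j ij; first by rewrite ei.
  have l_size : (l < size (u ++ k :: v))%N by lia.
  by rewrite ei; have /= := all_nthP 0%N uvk l l_size; lia.
(* A letter [k] inside [u] or [v] would repeat the one at position [size u], against [once]. *)
have uk : all (fun i => (i < k)%N) u.
  apply/(all_nthP 0%N) => i iu; have := allP uvk (nth 0%N u i).
  rewrite mem_cat mem_nth // ltnS => /(_ isT).
  rewrite leq_eqVlt => /orP[/eqP e|//].
  case: (once i (size u)); first by rewrite size_cat /=; lia.
    by rewrite nth_cat iu.
  by rewrite nth_cat ltnn subnn.
have vk : all (fun i => (i < k)%N) v.
  apply/(all_nthP 0%N) => i iv.
  have nthv : nth 0%N (u ++ k :: v) (size u + i.+1)%N = nth 0%N v i.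
    by rewrite nth_cat ltnNge leq_addr addKn.
  have := allP uvk (nth 0%N v i).
  rewrite mem_cat in_cons mem_nth // !orbT ltnS => /(_ isT).
  rewrite leq_eqVlt => /orP[/eqP e|//].
  case: (once (size u) (size u + i.+1)%N); first by rewrite size_cat /=; lia.
    by rewrite nth_cat ltnn subnn.
  by rewrite nthv.
move: adm; rewrite admissible_cat_max // => /andP[au av].
by apply/allpairsP; exists (u, v); rewrite !IH au uk av vk.
Qed.

Lemma uniq_admissible_words k : uniq (admissible_words k).
Proof.
elim: k => //= k IH; rewrite cat_uniq IH /=; apply/andP; split.
  apply/hasPn => _ /allpairsP[[s t] /= [_ _ ->]].
  by rewrite mem_admissible_words all_cat /= ltnn !andbF.
apply: allpairs_uniq => // -[s t] [s' t'] /=.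
have kN r : r \in admissible_words k -> k \notin r.
  rewrite mem_admissible_words => /andP[_ /allP rk].
  by apply/negP => /rk; rewrite ltnn.
move=> /allpairsP[[? ?] /= [/kN ks _ [-> ->]]].
move=> /allpairsP[[? ?] /= [/kN ks' _ [-> ->]]] e.
(* The first position of [k] gives the length of the left factor, so the word determines where it
   was cut. *)
have idx (r w : seq nat) : k \notin r -> index k (r ++ k :: w) = size r.
  by move=> kr; rewrite index_cat (negPf kr) /= eqxx addn0.
have := congr1 (index k) e; rewrite !idx // => esz.
by move/eqP: e; rewrite eqseq_cat // => /andP[/eqP -> /eqP[->]].
Qed.

(** * Division-free Gaussian elimination with pivots close to -1 *)

Section Elimination.

Variable R : comNzRingType.
Implicit Type A : nat -> nat -> R.

Fixpoint word_weight A (i : nat) (s : seq nat) (j : nat) : R :=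
  if s is k :: s' then A i k * word_weight A k s' j else A i j.

Lemma word_weight_cat A i s k t j :
  word_weight A i (s ++ k :: t) j = word_weight A i s k * word_weight A k t j.
Proof. by elim: s i => //= l s IH i; rewrite IH mulrA. Qed.

Fixpoint eliminate A (k i j : nat) : R :=
  if k is k'.+1 then
    eliminate A k' i j + eliminate A k' i k' * eliminate A k' k' j
  else A i j.

Lemma sum_admissible_words A k i j :
  \sum_(s <- admissible_words k) word_weight A i s j = eliminate A k i j.
Proof.
elim: k i j => [|k IH] i j /=; first by rewrite big_seq1.
rewrite big_cat /= IH big_allpairs_dep /= -!IH big_distrl /=; congr (_ + _).
apply: eq_bigr => s _; rewrite big_distrr /=.
by apply: eq_bigr => t _; rewrite word_weight_cat.
Qed.

(** Lets an induction on the matrix size strip off the first pivot, whereas [eliminate] recurses on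
    the last one. *)
Lemma eliminate_shift A k i j :
  eliminate (fun i j => eliminate A 1 i.+1 j.+1) k i j =
  eliminate A k.+1 i.+1 j.+1.
Proof. by elim: k i j => //= k IH i j; rewrite !IH. Qed.

(** Adding [dlsubmx M] times the top row to the lower rows keeps the determinant and makes every
    entry below the pivot a multiple of [1 + M 0 0]; then expand along the first column. *)
Lemma det_pivot m (M : 'M[R]_(1 + m)) :
  exists r, \det M =
    r * (1 + M 0 0) - \det (drsubmx M + dlsubmx M *m ursubmx M).
Proof.
set S := drsubmx M + _.
pose N := block_mx (ulsubmx M) (ursubmx M) ((1 + M 0 0) *: dlsubmx M) S.
have -> : \det M = \det N.
  have -> : N = block_mx 1%:M 0 (dlsubmx M) 1%:M *m M.
    rewrite -[X in _ = _ *m X]submxK mulmx_block !mul1mx !mul0mx !addr0 /N.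
    congr block_mx; last by rewrite addrC.
    rewrite [ulsubmx M]mx11_scalar mul_mx_scalar scalerDl scale1r addrC.
    by rewrite !mxE !lshift0.
  by rewrite det_mulmx det_lblock !det1 !mul1r.
pose r := \sum_(i < m) dlsubmx M i 0 * cofactor N (rshift 1 i) 0.
(* The pivot term is [M 0 0 * \det S], that is [(1 + M 0 0) * \det S - \det S]. *)
exists (r + \det S); rewrite (expand_det_col N 0) big_split_ord /= big_ord1.
rewrite lshift0.
have -> : N 0 0 = M 0 0.
  by rewrite -[0 in LHS](lshift0 m 0) block_mxEul !mxE !lshift0.
have -> : cofactor N 0 0 = \det S.
  rewrite /cofactor /= addn0 expr0 mul1r; congr (\det _).
  apply/matrixP => i j; rewrite [LHS]mxE [LHS]mxE.
  rewrite -[RHS](block_mxEdr (ulsubmx M) (ursubmx M) ((1 + M 0 0) *: dlsubmx M)).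
  by congr (N _ _); apply/val_inj.
have -> : \sum_(i < m) N (rshift 1 i) 0 * cofactor N (rshift 1 i) 0 =
          (1 + M 0 0) * r.
  rewrite big_distrr; apply: eq_bigr => i _ /=; rewrite mulrA; congr (_ * _).
  by rewrite -[0 in LHS](lshift0 m 0) block_mxEdl mxE.
by ring.
Qed.

(** Induction on the size through [det_pivot]: each pivot removed contributes one factor -1. *)
Lemma det_eliminate n A : exists a : nat -> R,
  \det (\matrix_(i < n.+1, j < n.+1) A i j) =
  (-1) ^+ n * eliminate A n n n +
  \sum_(i < n) a i * (1 + eliminate A i i i).
Proof.
elim: n A => [|n IH] A.
  by exists (fun=> 0); rewrite det_mx11 mxE big_ord0 expr0 mul1r addr0.
have [r ->] := @det_pivot n.+1 (\matrix_(i, j) A i j).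
have [a Ea] := IH (fun i j => eliminate A 1 i.+1 j.+1).
(* Index 0 is the pivot just removed; the coefficients of the smaller matrix move up by one and
   change sign. *)
exists (fun i => if i is i'.+1 then - a i' else r).
rewrite big_ord_recl /= mxE.
set S := _ + _ *m _.
have -> : S = \matrix_(i, j) eliminate A 1 i.+1 j.+1.
  by apply/matrixP => i j; rewrite /S !mxE big_ord1 !mxE.
rewrite Ea eliminate_shift opprD addrCA.
congr (_ + (_ + _)); first by rewrite exprS mulN1r mulNr.
rewrite -sumrN; apply: eq_bigr => i _.
by rewrite eliminate_shift mulNr.
Qed.

End Elimination.

(** * Ideals under a triangular change of generators *)

Section Ideals.

Variables (R : comNzRingType) (I : finType) (g : I -> R).

Lemma ideal_gen_lin x p p' :
  ideal_gen g p -> ideal_gen g p' -> ideal_gen g (x * p + p').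
Proof.
move=> [a ->] [b ->]; exists (fun i => x * a i + b i).
rewrite big_distrr -big_split; apply: eq_bigr => i _ /=.
by rewrite mulrDl mulrA.
Qed.

Lemma ideal_gen0 : ideal_gen g 0.
Proof. by exists (fun=> 0); rewrite big1 // => i _; rewrite mul0r. Qed.

Lemma ideal_gen_mem i : ideal_gen g (g i).
Proof.
exists (fun j => (j == i)%:R); rewrite (bigD1 i) //= eqxx mul1r big1 ?addr0 //.
by move=> j /negPf ->; rewrite mul0r.
Qed.

Lemma ideal_gen_sum (J : finType) (P : pred J) (a h : J -> R) :
  (forall j, P j -> ideal_gen g (h j)) ->
  ideal_gen g (\sum_(j | P j) a j * h j).
Proof.
move=> gh; elim/big_rec: _ => [|j p Pj gp]; first exact: ideal_gen0.
by apply: ideal_gen_lin => //; apply: gh.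
Qed.

End Ideals.

Lemma ideal_gen_unitriangular (R : comNzRingType) q (g h : 'I_q -> R) :
  (forall n : 'I_q, exists a : 'I_q -> R,
     h n = (-1) ^+ n * g n + \sum_(i < q | (i < n)%N) a i * g i) ->
  forall p, ideal_gen g p <-> ideal_gen h p.
Proof.
move=> tri.
have hg n : ideal_gen g (h n).
  have [a ->] := tri n; apply: ideal_gen_lin; first exact: ideal_gen_mem.
  by apply: ideal_gen_sum => i _; apply: ideal_gen_mem.
have gh m : forall n : 'I_q, (n < m)%N -> ideal_gen h (g n).
  elim: m => // m IH n; rewrite ltnS => nm; have [a Ea] := tri n.
  (* The diagonal coefficient is its own inverse, so [g n] is expressed by [h n] and earlier [g i],
     covered by induction. *)
  have -> : g n = (-1) ^+ n * h n +
                  \sum_(i < q | (i < n)%N) - ((-1) ^+ n * a i) * g i.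
    rewrite Ea mulrDr mulrA -expr2 sqrr_sign mul1r -addrA big_distrr -big_split.
    rewrite big1 ?addr0 // => i _ /=.
    by rewrite mulNr mulrA subrr.
  apply: ideal_gen_lin; first exact: ideal_gen_mem.
  by apply: ideal_gen_sum => i ni; apply: IH; apply: leq_trans ni nm.
move=> p; split=> -[a ->]; apply: ideal_gen_sum => i _; last exact: hg.
exact: gh (ltn_ord i).
Qed.

(** * Specialization to the indeterminates *)

(** Natural-number indices fit the recursion of [eliminate]; [inord] sends those out of range to
    0. *)
Definition Bnat q (i j : nat) : {mpoly int[q.+1 * q.+1]} :=
  B (inord i : 'I_q.+1) (inord j).

Lemma walk_word_weight q (i j : 'I_q.+1) s :
  walk i s j = word_weight (Bnat q) i [seq val k | k <- s] j.
Proof. by elim: s i => [|k s IH] i /=; rewrite /Bnat ?IH !inord_val. Qed.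

Lemma C_eliminate q (n : 'I_q.+1) : C n = eliminate (Bnat q) n n n.
Proof.
rewrite -sum_admissible_words /C.
under eq_bigr do rewrite walk_word_weight.
rewrite -(big_map (map val) xpredT (fun s => word_weight (Bnat q) n s n)).
(* Both lists are duplicate-free, so having the same members suffices. *)
apply/perm_big/uniq_perm.
- by rewrite map_inj_uniq ?fset_uniq //; apply/inj_map/val_inj.
- exact: uniq_admissible_words.
move=> s; rewrite mem_admissible_words; apply/mapP/idP => [[t]|/andP[adm sn]].
  by rewrite in_D => /andP[adm tn] ->; rewrite adm all_map.
have sK : map val (map (@inord q) s) = s.
  rewrite -map_comp map_id_in // => i /(allP sn) i_n /=.
  by rewrite inordK // (ltn_trans i_n).
exists (map (@inord q) s) => //; rewrite in_D /admissible_below sK adm.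
by move: sn; rewrite -{1}sK all_map.
Qed.

Theorem theorem4p4 (q : nat) (hq : (1 <= q)%N) (p : {mpoly int[q * q]}) :
  ideal_gen (fun n : 'I_q => 1 + C n) p <-> ideal_gen (fun n : 'I_q => L n) p.
Proof.
case: q hq p => // q _; apply: ideal_gen_unitriangular => n.
have [a Ea] := @det_eliminate _ n (Bnat q).
exists (fun i => a i); rewrite /L.
have -> : \matrix_(i < n.+1, j < n.+1)
            B (widen_ord (ltn_ord n) i) (widen_ord (ltn_ord n) j) =
          \matrix_(i < n.+1, j < n.+1) Bnat q i j.
  apply/matrixP => i j; rewrite !mxE /Bnat.
  by congr B; apply/val_inj; rewrite /= inordK // (leq_trans (ltn_ord _)).
rewrite Ea C_eliminate.
rewrite (big_ord_widen q.+1 (fun i => a i * (1 + eliminate (Bnat q) i i i)));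
  last exact: ltnW.
(* The constant [- (-1) ^+ n.+1] of [L n] equals [(-1) ^+ n] and supplies the 1 in
   [(-1) ^+ n * (1 + C n)]. *)
rewrite exprS mulN1r opprK addrAC mulrDr mulr1 [(-1) ^+ n + _]addrC.
by congr (_ + _); apply: eq_bigr => i _; rewrite C_eliminate.
Qed.
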